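(* Let $\Phi:\mathbb{R}\to[0,\infty)$ be a convex function, let $1\le l\le n$ be integers, and let $\phi=\{\phi_k: k=1,2,\dots,n\}$ be an $\mathfrak{M}_l$-multiplicative system of real random variables on a probability space satisfying $\|\phi_k\|_\infty\le 1$ for all $k$. Then there exist $\mathfrak{M}_l$-independent Rademacher random variables $r_k$, $k=1,2,\dots,n$ (on some probability space), such that for every choice of real coefficients $a_1,\dots,a_n$ $$\mathbf{E}\left[\Phi\left(\sum_{k=1}^n a_k\phi_k\right)\right]\le \mathbf{E}\left[\Phi\left(\sum_{k=1}^n a_k r_k\right)\right].$$
   Context: $\mathbb{Z}_n=\{1,2,\dots,n\}$, and $\mathfrak{M}_l$ denotes the family of all nonempty subsets of $\mathbb{Z}_n$ of cardinality at most $l$. A system of random variables $\phi_1,\dots,\phi_n$ is $\mathfrak{M}_l$-multiplicative if $\mathbf{E}[\phi_{n_1}\phi_{n_2}\cdots\phi_{n_\nu}]=0$ for every $\{n_1,\dots,n_\nu\}\in\mathfrak{M}_l$ (distinct indices). Random variables $r_1,\dots,r_n$ are $\mathfrak{M}_l$-independent if for every $\{n_1,\dots,n_\nu\}\in\mathfrak{M}_l$ the variables $r_{n_1},\dots,r_{n_\nu}$ are stochastically independent. A Rademacher random variable takes the values $1$ and $-1$ with probability $1/2$ each. *)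

(* Defs.v *)
From HB Require Import structures.
From mathcomp Require Import all_boot all_order all_algebra.
From mathcomp Require Import all_classical all_reals all_analysis.

Set Implicit Arguments.
Unset Strict Implicit.
Unset Printing Implicit Defensive.

Import Order.TTheory GRing.Theory Num.Theory.
Import numFieldNormedType.Exports.

Local Open Scope classical_set_scope.
Local Open Scope ring_scope.

(* The index set {1, ..., n} is represented by 'I_n = {0, ..., n - 1}. *)
Definition subsets_upto (n l : nat) : {set {set 'I_n}} :=
  [set J : {set 'I_n} | (0 < #|J| <= l)%N].

(* Integrability of the products is not assumed separately: a measurable
   function whose integral does not exist or diverges has integral -oo or +oo
   here, never 0. *)
Definition multiplicative_system d (T : measurableType d) (R : realType)
    (P : probability T R) (n : nat) (M : {set {set 'I_n}})
    (X : 'I_n -> {RV P >-> R}) : Prop :=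
  forall J : {set 'I_n}, J \in M ->
    ('E_P[fun w => (\prod_(k in J) X k w)%R] = 0)%E.

(* Product rule over all families of Borel sets; the rule for a subfamily of J
   is obtained by taking A k = setT for the other indices. *)
Definition independent_on d (T : measurableType d) (R : realType)
    (P : probability T R) (n : nat) (X : 'I_n -> {RV P >-> R})
    (J : {set 'I_n}) : Prop :=
  forall A : 'I_n -> set R, (forall k, measurable (A k)) ->
    P (\bigcap_(k in [set` J]) (X k @^-1` A k)) =
    (\prod_(k in J) P (X k @^-1` A k))%E.

Definition independent_system d (T : measurableType d) (R : realType)
    (P : probability T R) (n : nat) (M : {set {set 'I_n}})
    (X : 'I_n -> {RV P >-> R}) : Prop :=
  forall J : {set 'I_n}, J \in M -> independent_on X J.

Definition rademacher d (T : measurableType d) (R : realType)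
    (P : probability T R) (X : {RV P >-> R}) : Prop :=
  P (X @^-1` [set 1]) = (2^-1)%:E /\ P (X @^-1` [set -1]) = (2^-1)%:E.

(* Main.v *)
(* After changing phi on a null set, assume |phi_k| <= 1 everywhere. The Riesz
   products \prod_k (1 + e_k phi_k) / 2, for e in {-1, 1}^n, are then the weights
   of a random probability on {-1, 1}^n whose coordinates are independent with
   means phi_k; averaging them over the given space yields the law of r. In the
   law of at most l coordinates only the means of the products of at most l of
   the phi_k intervene, and they vanish, so this law is uniform. Conditionally on
   phi, \sum_k a_k r_k has mean \sum_k a_k phi_k, and the inequality is Jensen's. *)
Require Import Defs.
From HB Require Import structures.
From mathcomp Require Import all_boot all_order all_algebra.
From mathcomp Require Import all_classical all_reals all_analysis.
From mathcomp Require Import measurable_realfun ess_sup_inf ring lra.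

Set Implicit Arguments.
Unset Strict Implicit.
Unset Printing Implicit Defensive.

Import Order.TTheory GRing.Theory Num.Theory.
Import numFieldNormedType.Exports.

Local Open Scope classical_set_scope.
Local Open Scope ring_scope.

(** * Convex functions on the line: finite Jensen inequality and measurability *)

Section ConvexFunction.
Variables (R : realType) (Phi : R -> R).
Hypothesis Phi_convex : convex_function [set: R^o] (Phi : R^o -> R^o).

Lemma convex_functionP (t x y : R) : 0 <= t <= 1 ->
  Phi (t * x + (1 - t) * y) <= t * Phi x + (1 - t) * Phi y.
Proof.
case/andP=> t0 t1.
by have := @Phi_convex (Itv01 t0 t1) x y (in_setT _) (in_setT _).
Qed.

Lemma convex_function_sum (I : finType) (p x : I -> R) :
    (forall i, 0 <= p i) -> \sum_i p i = 1 ->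
  Phi (\sum_i p i * x i) <= \sum_i p i * Phi (x i).
Proof.
move=> p0 p1.
(* Multiplying through by the total mass lets the induction run over sublists, whose weights need
   not sum to 1. *)
suff jensen (s : seq I) : 0 < \sum_(i <- s) p i ->
    Phi ((\sum_(i <- s) p i * x i) / \sum_(i <- s) p i) * \sum_(i <- s) p i <=
    \sum_(i <- s) p i * Phi (x i).
  by have := jensen (index_enum I); rewrite p1 divr1 mulr1; apply.
elim: s => [|i s IHs]; first by rewrite big_nil ltxx.
rewrite !big_cons; set c := \sum_(j <- s) p j; set S := \sum_(j <- s) p j * x j.
(* If the tail has mass 0, its barycentre [S / c] is meaningless, but then all its weights vanish
   and only [x i] remains. *)
move=> pc0; have [c0|c0] := ltP 0 c; last first.
  have ps0 j : j \in s -> p j = 0.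
    move=> js; apply/eqP; rewrite eq_le p0 andbT (le_trans _ c0)//.
    by rewrite /c (big_rem j)//= lerDl sumr_ge0.
  have c00 : c = 0 by rewrite /c big_seq big1.
  have S0 : S = 0 by rewrite /S big_seq big1// => j /ps0 ->; rewrite mul0r.
  have -> : \sum_(j <- s) p j * Phi (x j) = 0.
    by rewrite big_seq big1// => j /ps0 ->; rewrite mul0r.
  rewrite S0 c00 !addr0 mulrC; rewrite c00 addr0 in pc0.
  by rewrite [p i * x i]mulrC mulfK ?gt_eqF.
(* The barycentre of the whole list lies between [x i] and the barycentre [S / c] of the tail; this
   is its coefficient on [x i]. *)
have t01 : 0 <= p i / (p i + c) <= 1.
  by rewrite divr_ge0 ?(ltW pc0)//= ler_pdivrMr// mul1r lerDl ltW.
have cn0 : c != 0 by rewrite gt_eqF.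
have pcn0 : p i + c != 0 by rewrite gt_eqF.
have := convex_functionP (x i) (S / c) t01.
rewrite -(ler_pM2r pc0).
have -> : p i / (p i + c) * x i + (1 - p i / (p i + c)) * (S / c) =
  (p i * x i + S) / (p i + c) by field; rewrite cn0 pcn0.
move=> /le_trans; apply.
have -> : (p i / (p i + c) * Phi (x i) +
  (1 - p i / (p i + c)) * Phi (S / c)) * (p i + c) =
  p i * Phi (x i) + Phi (S / c) * c by field.
by rewrite lerD2l IHs.
Qed.

(** By convexity the strict sublevel sets of [Phi] are intervals, hence Borel; their complements are
    the preimages of the generating rays [[r, +oo[]. *)
Lemma measurable_convex_function : measurable_fun [set: R] Phi.
Proof.
apply: (measurability (@RGenCInfty.G R)) => [|/= _ [_] [r] -> <-].
  exact: RGenCInfty.measurableE.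
apply: measurableI => //; rewrite -[X in measurable X]setCK.
apply: measurableC; apply: is_interval_measurable => s t/=.
rewrite !in_itv/= !andbT => /negP; rewrite -ltNge => Ps.
move=> /negP; rewrite -ltNge => Pt u /andP[su ut].
apply/negP; rewrite in_itv/= andbT -ltNge.
have [st|ts] := ltP s t; last first.
  suff -> : u = s by [].
  by apply/eqP; rewrite eq_le su andbT (le_trans ut).
have ts0 : 0 < t - s by rewrite subr_gt0.
(* The coefficient of [s] when [u] is written as a convex combination of [s] and [t]. *)
have a01 : 0 <= (t - u) / (t - s) <= 1.
  by rewrite divr_ge0 ?subr_ge0 ?(ltW st)//= ler_pdivrMr// mul1r lerD2l lerN2.
case/andP: (a01) => a0 a1.
have := convex_functionP s t a01.
have -> : (t - u) / (t - s) * s + (1 - (t - u) / (t - s)) * t = u.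
  by field; rewrite gt_eqF.
move=> /le_lt_trans; apply; move: a0 a1.
set a := _ / _; rewrite le_eqVlt => /predU1P[<- _|a0 a1].
  by rewrite mul0r add0r subr0 mul1r.
by nra.
Qed.

End ConvexFunction.

(* The space is nat because it carries the discrete sigma-algebra; S is
   enumerated by its first #|S| points and the others get no mass. *)
Lemma finite_probability (R : realType) (S : finType) (p : S -> R) :
    (forall s, 0 <= p s) -> \sum_s p s = 1 ->
  exists (P : probability nat R) (X : nat -> S), forall f : S -> R,
    (forall s, 0 <= f s) -> 'E_P[f \o X]%E = (\sum_s p s * f s)%:E.
Proof.
move=> p0 p1.
(* An empty [S] would have total mass 0, so there is a point [s0] to serve as default value of
   [nth]. *)
have [s0|S0] := pickP (fun _ : S => true); last first.
  by move: p1; rewrite big1 => [/eqP|s]; [rewrite eq_sym oner_eq0|have := S0 s].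
move=> _; pose X (i : nat) : S := nth s0 (enum S) i.
pose m i : {measure set nat -> \bar R} := mscale (NngNum (p0 (X i))) \d_i.
pose Q : {measure set nat -> \bar R} := msum m #|S|.
have intQ (f : S -> R) : (forall s, 0 <= f s) ->
    (\int[Q]_i (f (X i))%:E)%E = (\sum_s p s * f s)%:E.
  move=> f0; rewrite ge0_integral_measure_sum//; last first.
    by move=> i _; rewrite lee_fin.
  under eq_bigr => i _.
    rewrite ge0_integral_mscale//; last by move=> j _; rewrite lee_fin.
    rewrite integral_dirac//= diracT mul1e -EFinM; over.
  rewrite sumEFin; congr (_%:E).
  rewrite -(big_mkord xpredT (fun i => p (X i) * f (X i))) /X cardE.
  by rewrite -(big_nth s0 xpredT (fun s => p s * f s)) big_enum.
have QT : Q setT = 1%E.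
  have := intQ (cst 1) (fun=> ler01).
  rewrite (eq_integral (cst 1%E))// integral_cst// mul1e => ->.
  by under eq_bigr do rewrite mulr1; rewrite p1.
pose isP := Measure_isProbability.Build _ _ _ (Q : set nat -> \bar R) QT.
pose P : probability nat R := HB.pack (Q : set nat -> \bar R) Q isP.
by exists P, X => f f0; rewrite unlock -intQ.
Qed.

(* The weight of the sign vector ((-1) ^+ eps k)_k, where false stands for +1. *)
Definition riesz_weight (R : realType) n (x : 'I_n -> R)
    (eps : {ffun 'I_n -> bool}) : R :=
  \prod_k ((1 + (-1) ^+ eps k * x k) / 2).

(** * Riesz weights at a fixed point: moments, positivity, Jensen *)

Section RieszWeight.
Variables (R : realType) (n : nat) (x : 'I_n -> R).

(** The sum over sign vectors factorises over the coordinates; each factor is the mean of [h k]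
    under a sign of mean [x k], written as an affine function of [x k]. *)
Lemma sum_riesz_weight_prod (h : 'I_n -> bool -> R) :
  \sum_eps riesz_weight x eps * \prod_k h k (eps k) =
  \prod_k ((h k false + h k true) / 2 + (h k false - h k true) / 2 * x k).
Proof.
under [LHS]eq_bigr do rewrite -big_split/=.
rewrite -(bigA_distr_bigA (fun (k : 'I_n) (b : bool) =>
  (1 + (-1) ^+ b * x k) / 2 * h k b))/=.
by apply: eq_bigr => k _; rewrite big_bool/= expr1 expr0; field.
Qed.

Lemma sum_riesz_weight : \sum_eps riesz_weight x eps = 1.
Proof.
transitivity (\sum_eps riesz_weight x eps * \prod_(k < n) (fun=> 1) (eps k)).
  by apply: eq_bigr => eps _; rewrite big1 ?mulr1.
rewrite (sum_riesz_weight_prod (fun _ _ => 1)) big1// => k _.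
by field.
Qed.

Lemma mean_riesz_weight (k : 'I_n) :
  \sum_eps riesz_weight x eps * (-1) ^+ eps k = x k.
Proof.
pose h j (b : bool) : R := if j == k then (-1) ^+ b else 1.
transitivity (\sum_eps riesz_weight x eps * \prod_j h j (eps j)).
  apply: eq_bigr => eps _; rewrite (bigD1 k)//= big1 /h ?eqxx ?mulr1//.
  by move=> j /negbTE ->.
rewrite sum_riesz_weight_prod (bigD1 k)//= big1 /h ?eqxx => [|j /negbTE ->].
  by rewrite expr0 expr1; field.
by field.
Qed.

Hypothesis x1 : forall k, `|x k| <= 1.

Lemma riesz_weight_ge0 eps : 0 <= riesz_weight x eps.
Proof.
apply: prodr_ge0 => k _; have := x1 k; rewrite ler_norml => /andP[? ?].
by case: (eps k); rewrite ?expr0 ?expr1; lra.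
Qed.

Lemma riesz_weight_le1 eps : riesz_weight x eps <= 1.
Proof.
rewrite -sum_riesz_weight (bigD1 eps)//= lerDl sumr_ge0// => *.
exact: riesz_weight_ge0.
Qed.

(** Under the weights, the signed sum has mean [\sum_k a k * x k], by linearity and
    [mean_riesz_weight]. *)
Lemma riesz_weight_jensen (Phi : R -> R) (a : 'I_n -> R) :
    convex_function [set: R^o] (Phi : R^o -> R^o) ->
  Phi (\sum_k a k * x k) <=
  \sum_eps riesz_weight x eps * Phi (\sum_k a k * (-1) ^+ eps k).
Proof.
move=> Phi_convex.
have <- : \sum_eps riesz_weight x eps * (\sum_k a k * (-1) ^+ eps k) =
    \sum_k a k * x k.
  under eq_bigr do rewrite mulr_sumr.
  rewrite exchange_big/=; apply: eq_bigr => k _.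
  by under eq_bigr do rewrite mulrCA; rewrite -mulr_sumr mean_riesz_weight.
apply: (convex_function_sum Phi_convex (p := riesz_weight x)).
  exact: riesz_weight_ge0.
exact: sum_riesz_weight.
Qed.

End RieszWeight.

(** * Averaging the Riesz weights over a bounded system *)

Section BoundedSystem.
Context d (T : measurableType d) (R : realType) (P : probability T R).

Lemma expectation_lincomb (I : finType) (a : I -> R) (f : I -> T -> R) :
    (forall i, measurable_fun setT (f i)) -> (forall i w, `|f i w| <= 1) ->
  'E_P[fun w => (\sum_i a i * f i w)%R]%E =
    (\sum_i a i * fine ('E_P[f i])%E)%:E.
Proof.
move=> mf f1.
have intf i : P.-integrable setT (EFin \o f i).
  apply: measurable_bounded_integrable => //.
    exact: le_lt_trans (probability_le1 P measurableT) (ltry _).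
  by exists 1; split=> // M M1 w _ /=; rewrite (le_trans (f1 i w))// ltW.
rewrite unlock; under eq_integral do rewrite -sumEFin.
rewrite integral_sum//; last first.
  by move=> i; under eq_fun do rewrite EFinM;
    exact: (integrableZl measurableT (a i) (intf i)).
rewrite -sumEFin; apply: eq_bigr => i _.
rewrite (integralZl measurableT (intf i)) EFinM fineK//.
exact: (integrable_fin_num measurableT (intf i)).
Qed.

Variables (n : nat) (psi : 'I_n -> T -> R).
Hypothesis mpsi : forall k, measurable_fun setT (psi k).
Hypothesis psi1 : forall k w, `|psi k w| <= 1.

(** Expand the product over the sets [K] of indices where the [e] term is chosen. A [K] not inside
    [J] has a zero coefficient, a nonempty [K] inside [J] has a zero moment, and the empty set
    leaves the product of the [c k]. *)
Lemma expectation_prod_affine (J : {set 'I_n}) (c e : 'I_n -> R) :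
    (forall K : {set 'I_n}, K != finset.set0 -> K \subset J ->
      'E_P[fun w => (\prod_(k in K) psi k w)%R]%E = 0%E) ->
    (forall k, k \notin J -> e k = 0) ->
  'E_P[fun w => (\prod_k (c k + e k * psi k w))%R]%E = (\prod_k c k)%:E.
Proof.
move=> psi0 e0.
pose b (K : {set 'I_n}) := \prod_k (if k \in K then e k else c k).
have -> : (fun w => \prod_k (c k + e k * psi k w)) =
    fun w => \sum_(K : {set 'I_n}) b K * \prod_(k in K) psi k w.
  apply/funext => w; under eq_bigr do rewrite addrC.
  rewrite bigA_distr; apply: eq_bigr => K _.
  rewrite [X in _ = _ * X]big_mkcond -big_split/=.
  by apply: eq_bigr => k _; case: ifP => _; rewrite ?mulr1.
rewrite expectation_lincomb; last 2 first.
- by move=> K; under eq_fun do rewrite -big_enum; exact: measurable_prod.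
- by move=> K w; rewrite normr_prod prodr_ile1// => k; rewrite normr_ge0 psi1.
rewrite (bigD1 finset.set0)//= [X in _ + X]big1 => [|K K0].
  under [X in 'E_P[X]%E]eq_fun do rewrite big_set0.
  rewrite expectation_cst/= mulr1 addr0; congr (_%:E).
  by apply: eq_bigr => k _; rewrite inE.
have [KJ|] := boolP (K \subset J); first by rewrite psi0//= mulr0.
case/subsetPn => k kK kJ; rewrite /b (bigD1 k)//= kK e0//.
by rewrite !mul0r.
Qed.

Lemma measurable_riesz_weight eps :
  measurable_fun setT (fun w => riesz_weight (psi^~ w) eps).
Proof.
rewrite /riesz_weight; apply: measurable_prod => k _.
apply: measurable_funM => //; apply: measurable_funD => //.
exact: measurable_funM.
Qed.

(** The law of [X] gives [eps] the mean over [P] of its Riesz weight; these means sum to 1 because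
    the weights do at every point. *)
Lemma riesz_probability :
  exists (Q : probability nat R) (X : nat -> {ffun 'I_n -> bool}),
    forall g : {ffun 'I_n -> bool} -> R, (forall eps, 0 <= g eps) ->
    'E_Q[g \o X]%E =
    'E_P[fun w => (\sum_eps riesz_weight (psi^~ w) eps * g eps)%R]%E.
Proof.
pose q eps w := riesz_weight (psi^~ w) eps.
have q0 eps w : 0 <= q eps w by exact: riesz_weight_ge0.
have q1 eps w : `|q eps w| <= 1 by rewrite ger0_norm// riesz_weight_le1.
have Eq g : 'E_P[fun w => (\sum_eps q eps w * g eps)%R]%E =
    (\sum_eps fine ('E_P[q eps])%E * g eps)%:E.
  under [X in 'E_P[X]%E]eq_fun do under eq_bigr do rewrite mulrC.
  rewrite expectation_lincomb//; last exact: measurable_riesz_weight.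
  by under eq_bigr do rewrite mulrC.
have [||Q [X EX]] := @finite_probability R _ (fun eps => fine ('E_P[q eps])%E).
- by move=> eps; rewrite fine_ge0// expectation_ge0.
- apply: EFin_inj; transitivity ('E_P[cst 1%R])%E; last exact: expectation_cst.
  transitivity ('E_P[fun w => (\sum_eps q eps w * 1)%R])%E.
    by rewrite Eq; under [in RHS]eq_bigr do rewrite mulr1.
  congr expectation; apply/funext => w /=.
  by under eq_bigr do rewrite mulr1; exact: sum_riesz_weight.
by exists Q, X => g g0; rewrite EX// Eq.
Qed.

End BoundedSystem.

Lemma Lnorm_infty_le_ae d (T : measurableType d) (R : realType)
    (P : probability T R) (f : T -> R) (c : R) :
  ('N[P]_+oo[EFin \o f] <= c%:E)%E -> {ae P, forall w, `|f w| <= c}.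
Proof.
have PT : (0 < P setT)%E by rewrite [P setT]probability_setT lte01.
rewrite unlock /Lnorm PT => /ess_supP.
by apply: filterS => w /=; rewrite lee_fin.
Qed.

Theorem corollary1p1 (R : realType) (Phi : R -> R)
    (Phi_ge0 : forall x : R, 0 <= Phi x)
    (Phi_convex : convex_function [set: R^o] (Phi : R^o -> R^o))
    (n l : nat) (l_ge1 : (1 <= l)%N) (l_le_n : (l <= n)%N)
    (d : measure_display) (T : measurableType d) (P : probability T R)
    (phi : 'I_n -> {RV P >-> R})
    (phi_mult : multiplicative_system (subsets_upto n l) phi)
    (phi_bound : forall k : 'I_n,
      ('N[P]_+oo[EFin \o phi k] <= 1)%E) :
  exists (d' : measure_display) (T' : measurableType d')
         (P' : probability T' R) (r : 'I_n -> {RV P' >-> R}),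
    [/\ independent_system (subsets_upto n l) r,
        (forall k : 'I_n, rademacher (r k)) &
        forall a : 'I_n -> R,
          ('E_P[fun w => Phi (\sum_(k < n) a k * phi k w)%R] <=
           'E_P'[fun w => Phi (\sum_(k < n) a k * r k w)%R])%E].
Proof.
(* Truncation to [-1, 1] makes the Riesz weights nonnegative at every point, not just almost
   everywhere. *)
pose psi k w := Num.max (-1) (Num.min 1 (phi k w)).
have mpsi k : measurable_fun setT (psi k).
  by apply: measurable_maxr => //; apply: measurable_minr.
have psi1 k w : `|psi k w| <= 1.
  by rewrite ler_norml /psi le_max lexx/= ge_max ge_min lexx/= andbT; lra.
have psiE : {ae P, forall w, forall k, psi k w = phi k w}.
  apply: filter_forall => k; have := Lnorm_infty_le_ae (phi_bound k).
  apply: filterS => w; rewrite ler_norml => /andP[? ?].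
  by rewrite /psi min_r// max_r.
have psi_mult (J K : {set 'I_n}) : (#|J| <= l)%N -> K != finset.set0 ->
    K \subset J -> 'E_P[fun w => (\prod_(k in K) psi k w)%R]%E = 0%E.
  move=> Jl K0 KJ; rewrite -(phi_mult K); last first.
    by rewrite inE card_gt0 K0 (leq_trans (subset_leq_card KJ)).
  rewrite unlock; apply: ae_eq_integral => //.
  - apply/measurable_EFinP; under eq_fun do rewrite -big_enum.
    exact: measurable_prod.
  - apply/measurable_EFinP; under eq_fun do rewrite -big_enum.
    exact: measurable_prod.
  - apply: filterS psiE => w psiw _ /=; congr (_%:E).
    by apply: eq_bigr => k _; rewrite psiw.
have [Q [X EX]] := riesz_probability P mpsi psi1.
have mr k : measurable_fun setT (fun i => (-1) ^+ X i k : R) by [].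
pose r k : {RV Q >-> R} :=
  HB.pack (fun i => (-1) ^+ X i k : R) (isMeasurableFun.Build _ _ _ _ _ (mr k)).
(* The mass that the Rademacher law gives to [A]. *)
pose avg (A : set R) : R := (\1_A 1 + \1_A (-1)) / 2.
have law (J : {set 'I_n}) (A : 'I_n -> set R) : (#|J| <= l)%N ->
    Q (\bigcap_(k in [set` J]) (r k @^-1` A k)) = (\prod_(k in J) avg (A k))%:E.
  move=> Jl.
  (* The indicator of the event is a product of one-coordinate functions, constant off [J]; so off
     [J] the affine factors have slope 0. *)
  pose h k (b : bool) : R := if k \in J then \1_(A k) ((-1) ^+ b) else 1.
  rewrite -expectation_indic//.
  have -> : \1_(\bigcap_(k in [set` J]) (r k @^-1` A k)) =
      (fun eps : {ffun 'I_n -> bool} => \prod_k h k (eps k)) \o X :> (nat -> R).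
    apply/funext => i; rewrite /= indicE.
    have [iA|iA] := boolP (i \in _).
      rewrite big1// => k _; rewrite /h; case: ifPn => // kJ.
      by rewrite indicE mem_set//; move/set_mem: iA; apply.
    move: iA; rewrite notin_setE => /existsNP[k] /not_implyP[kJ kA].
    by rewrite (bigD1 k)//= /h kJ indicE memNset// mul0r.
  rewrite EX; last first.
    by move=> eps; apply: prodr_ge0 => k _; rewrite /h; case: ifP.
  under [X in 'E_P[X]%E]eq_fun do rewrite sum_riesz_weight_prod.
  rewrite (expectation_prod_affine mpsi psi1 (J := J)); last 2 first.
  - by move=> K; exact: psi_mult.
  - by move=> k /negbTE kJ; rewrite /h kJ subrr mul0r.
  rewrite [in RHS]big_mkcond; congr (_%:E); apply: eq_bigr => k _.
  by rewrite /h /avg expr0 expr1; case: ifP => // _; field.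
(* The case of a singleton [J], which is allowed because [1 <= l]. *)
have law1 k A : Q (r k @^-1` A) = (avg A)%:E.
  have := law (finset.set1 k) (fun=> A).
  rewrite cards1 big_set1 => <-//; congr (Q _).
  apply/seteqP; split => [i iA j /set1P ->//|i]; apply.
  by rewrite /= inE.
exists _, nat, Q, r; split.
- move=> J; rewrite inE => /andP[_ Jl] A _.
  rewrite law// -prodEFin; apply: eq_bigr => k _; exact/esym/law1.
- move=> k; have n1N1 : (1 : R) <> -1 by move=> ?; lra.
  split; rewrite law1 /avg !indicE; congr (_%:E).
    by rewrite mem_set// memNset ?addr0 ?mul1r// => /esym.
  by rewrite memNset// mem_set// add0r mul1r.
- move=> a.
  (* The middle term integrates the conditional mean given [phi]: Jensen bounds the left side almost
     everywhere, and [EX], applicable as [Phi] is nonnegative, identifies it with the right side. *)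
  apply: (@le_trans _ _ ('E_P[fun w => (\sum_eps
    riesz_weight (psi^~ w) eps * Phi (\sum_k a k * (-1) ^+ eps k))%R])%E).
    apply: expectation_le => //.
    + apply: (measurableT_comp (measurable_convex_function Phi_convex)).
      by apply: measurable_sum => k; exact: measurable_funM.
    + apply: measurable_sum => eps; apply: measurable_funM => //.
      exact: measurable_riesz_weight.
    + move=> w; apply: sumr_ge0 => eps _; rewrite mulr_ge0//.
      exact: riesz_weight_ge0.
    + apply: filterS psiE => w psiw.
      under eq_bigr do rewrite -psiw.
      exact: (riesz_weight_jensen (x := psi^~ w)).
  by rewrite -(EX (fun eps => Phi (\sum_k a k * (-1) ^+ eps k))).
Qed.
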